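(* Let $\bm{\theta}_a$ and $\bm{\theta}_b$ be (trained) $L$-layer multilayer perceptrons of the same architecture with weight matrices $\bm{W}_\ell^{(a)},\bm{W}_\ell^{(b)}\in\mathbb{R}^{d_\ell\times d_{\ell-1}}$, $\ell=1,\dots,L$, with singular value decompositions $\bm{W}_\ell^{(a)}=\sum_i \bm{u}_{\ell,i}^{(a)}s_{\ell,i}^{(a)}(\bm{v}_{\ell,i}^{(a)})^\top$ and $\bm{W}_\ell^{(b)}=\sum_j \bm{u}_{\ell,j}^{(b)}s_{\ell,j}^{(b)}(\bm{v}_{\ell,j}^{(b)})^\top$. Then the weight matching problem of minimizing $\|\bm{\theta}_a-\pi(\bm{\theta}_b)\|^2$ over permutations $\pi=(\bm{P}_\ell)_\ell$ is equivalent to the following maximization problem, i.e. the sets of optimal $\pi$ coincide: $$\operatorname*{arg\,min}_\pi\|\bm{\theta}_a-\pi(\bm{\theta}_b)\|^2=\operatorname*{arg\,max}_{\pi=(\bm{P}_\ell)_\ell}\sum_{\ell,i,j}s_{\ell,i}^{(a)}s_{\ell,j}^{(b)}\,(\bm{u}_{\ell,i}^{(a)})^\top(\bm{P}_\ell\bm{u}_{\ell,j}^{(b)})\,(\bm{v}_{\ell,i}^{(a)})^\top(\bm{P}_{\ell-1}\bm{v}_{\ell,j}^{(b)}).$$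
   Context: Only weights (not biases) are considered as parameters. A permutation $\pi=(\bm{P}_\ell)_\ell$ is a tuple of permutation matrices $\bm{P}_\ell$ of size $d_\ell\times d_\ell$ with $\bm{P}_0=\bm{I}$ and $\bm{P}_L=\bm{I}$; $\pi(\bm{\theta}_b)$ has weights $\bm{P}_\ell\bm{W}_\ell^{(b)}\bm{P}_{\ell-1}^\top$. Thus $$\|\bm{\theta}_a-\pi(\bm{\theta}_b)\|^2=\sum_{\ell=1}^L\|\bm{W}_\ell^{(a)}-\bm{P}_\ell\bm{W}_\ell^{(b)}\bm{P}_{\ell-1}^\top\|^2,$$ where $\|\cdot\|$ on matrices is the Frobenius norm. In each singular value decomposition the $s$'s are the singular values in descending order, and the $\bm{u}$'s and $\bm{v}$'s are the corresponding orthonormal left and right singular vectors. *)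

(* Defs.v *)
From mathcomp Require Import all_boot all_order all_algebra.
From mathcomp Require Import classical_sets reals.

Set Implicit Arguments.
Unset Strict Implicit.
Unset Printing Implicit Defensive.

Import Order.TTheory GRing.Theory Num.Theory.
Local Open Scope ring_scope.
Local Open Scope classical_set_scope.

Section LinearAlgebra.
Variable R : realType.

(* The norm `|A| that the analysis library puts on matrices is the max norm,
   hence this separate definition. *)
Definition frobenius m n (A : 'M[R]_(m, n)) : R :=
  Num.sqrt (\sum_(i < m) \sum_(j < n) A i j ^+ 2).

Definition dot n (x y : 'cV[R]_n) : R := (x^T *m y) ord0 ord0.

Definition orthonormal r n (x : 'I_r -> 'cV[R]_n) : Prop :=
  forall i j, dot (x i) (x j) = (i == j)%:R.

(* The number r of terms is left free: orthonormality and the last clause force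
   \rank W <= r <= minn m n, so the compact decomposition (r = \rank W) and the
   thin one (r = minn m n) are both instances. *)
Definition is_svd m n r (W : 'M[R]_(m, n)) (u : 'I_r -> 'cV[R]_m)
    (s : 'I_r -> R) (v : 'I_r -> 'cV[R]_n) : Prop :=
  [/\ orthonormal u,
      orthonormal v,
      forall i, 0 <= s i,
      forall i j : 'I_r, (i <= j)%N -> s j <= s i
    & W = \sum_(i < r) s i *: (u i *m (v i)^T)].

End LinearAlgebra.

Section ArgExtremum.
Variables (R : realType) (T : Type).

Definition argmin (D : set T) (f : T -> R) : set T :=
  [set x | D x /\ forall y, D y -> f x <= f y].

Definition argmax (D : set T) (f : T -> R) : set T :=
  [set x | D x /\ forall y, D y -> f y <= f x].

End ArgExtremum.

(* Layers 1, ..., L are indexed by 'I_L and widths d_0, ..., d_L by 'I_L.+1: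
   layer index k : 'I_L stands for layer l = k + 1, with output width
   d (lout k) = d_l and input width d (lin k) = d_(l-1). *)
Definition lin L (k : 'I_L) : 'I_L.+1 := widen_ord (leqnSn L) k.
Definition lout L (k : 'I_L) : 'I_L.+1 := lift ord0 k.

Section WeightMatching.
Variables (R : realType) (L : nat) (d : 'I_L.+1 -> nat).

(* Biases are not parameters. *)
Definition mlp : Type := forall k : 'I_L, 'M[R]_(d (lout k), d (lin k)).

Definition mx_family : Type := forall l : 'I_L.+1, 'M[R]_(d l).

Definition perm_tuples : set mx_family :=
  [set P | [/\ forall l, is_perm_mx (P l),
               P ord0 = 1%:M
             & P ord_max = 1%:M]].

Definition permute (P : mx_family) (theta : mlp) : mlp :=
  fun k => P (lout k) *m theta k *m (P (lin k))^T.

Definition sqdist (theta theta' : mlp) : R :=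
  \sum_(k < L) frobenius (theta k - theta' k) ^+ 2.

End WeightMatching.

Arguments perm_tuples R {L} d.

(* Main.v *)
Require Import Defs.
From mathcomp Require Import all_boot all_order all_algebra.
From mathcomp Require Import classical_sets reals.
From mathcomp Require Import perm.
From mathcomp Require Import ring.

(** Permutation matrices are orthogonal, so with <A, B> = tr (A^T B) the squared
    Frobenius distance from W_a to P W_b Q^T is
    |W_a|^2 + |W_b|^2 - 2 <W_a, P W_b Q^T>. Only the last term depends on the
    permutations, and expanding both singular value decompositions turns it
    into the objective of the maximization problem. *)

Set Implicit Arguments.
Unset Strict Implicit.
Unset Printing Implicit Defensive.

Import Order.TTheory GRing.Theory Num.Theory.
Local Open Scope ring_scope.

Lemma perm_mx_orthogonal (R : comNzRingType) n (P : 'M[R]_n) :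
  is_perm_mx P -> P^T *m P = 1%:M.
Proof.
by case/is_perm_mxP=> s ->; rewrite tr_perm_mx -perm_mxM mulVg perm_mx1.
Qed.

Lemma frobenius_sqr (R : realType) m n (A : 'M[R]_(m, n)) :
  frobenius A ^+ 2 = \tr (A^T *m A).
Proof.
rewrite sqr_sqrtr; last by do 2!apply: sumr_ge0 => ? _; exact: sqr_ge0.
(* The diagonal of [A^T *m A] runs over the columns of [A], so the column sum has to come first. *)
rewrite exchange_big; apply: eq_bigr => j _; rewrite mxE.
by apply: eq_bigr => i _; rewrite mxE expr2.
Qed.

Lemma frobenius_sqrB (R : realType) m n (A B : 'M[R]_(m, n)) :
  frobenius (A - B) ^+ 2
  = frobenius A ^+ 2 + frobenius B ^+ 2 - 2 * \tr (A^T *m B).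
Proof.
rewrite !frobenius_sqr [(A - B)^T]linearB /= mulmxBl !mulmxBr !linearB /=.
have -> : \tr (B^T *m A) = \tr (A^T *m B).
  by rewrite -mxtrace_tr trmx_mul trmxK.
ring.
Qed.

(** Cyclicity of the trace first brings [Q^T] next to [Q], then [P^T] next to [P], and both pairs
    cancel. *)
Lemma frobenius_sqr_orthogonal (R : realType) m n (P : 'M[R]_m) (Q : 'M[R]_n)
    (A : 'M[R]_(m, n)) :
  P^T *m P = 1%:M -> Q^T *m Q = 1%:M ->
  frobenius (P *m A *m Q^T) ^+ 2 = frobenius A ^+ 2.
Proof.
move=> PK QK; rewrite !frobenius_sqr !trmx_mul trmxK mxtrace_mulC -!mulmxA.
rewrite (mulmxA Q^T) QK mul1mx mxtrace_mulC -!mulmxA PK mulmx1.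
exact: mxtrace_mulC.
Qed.

Lemma mxtrace_rank1 (R : realType) m n (P : 'M[R]_m) (Q : 'M[R]_n)
    (u u' : 'cV[R]_m) (v v' : 'cV[R]_n) :
  \tr ((u *m v^T)^T *m (P *m (u' *m v'^T) *m Q^T))
  = dot u (P *m u') * dot v (Q *m v').
Proof.
have -> : (u *m v^T)^T *m (P *m (u' *m v'^T) *m Q^T)
    = v *m ((u^T *m (P *m u')) *m (Q *m v')^T).
  by rewrite !trmx_mul trmxK !mulmxA.
(* The middle factor is a 1 x 1 matrix, so it leaves the trace as a scalar; what remains is the
   trace of the 1 x 1 matrix [(Q *m v')^T *m v]. *)
rewrite mxtrace_mulC [u^T *m (P *m u')]mx11_scalar mul_scalar_mx -scalemxAl.
rewrite mxtraceZ; congr (_ * _).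
by rewrite -mxtrace_tr trmx_mul trmxK /mxtrace big_ord1.
Qed.

(** Bilinearity reduces this to pairs of rank-one terms. It gives one layer of the objective, with
    [P] acting on outputs and [Q] on inputs. *)
Lemma mxtrace_sum_rank1 (R : realType) m n r r' (P : 'M[R]_m) (Q : 'M[R]_n)
    (u : 'I_r -> 'cV[R]_m) (s : 'I_r -> R) (v : 'I_r -> 'cV[R]_n)
    (u' : 'I_r' -> 'cV[R]_m) (s' : 'I_r' -> R) (v' : 'I_r' -> 'cV[R]_n) :
  \tr ((\sum_i s i *: (u i *m (v i)^T))^T
       *m (P *m (\sum_j s' j *: (u' j *m (v' j)^T)) *m Q^T))
  = \sum_i \sum_j s i * s' j * dot (u i) (P *m u' j) * dot (v i) (Q *m v' j).
Proof.
rewrite [(\sum_i _)^T]linear_sum mulmx_suml linear_sum /=.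
apply: eq_bigr => i _; rewrite mulmx_sumr mulmx_suml mulmx_sumr linear_sum /=.
apply: eq_bigr => j _.
rewrite [(s i *: _)^T]linearZ /= -scalemxAr -!scalemxAl -scalemxAr.
rewrite !mxtraceZ mxtrace_rank1.
ring.
Qed.

(** The order reversal is asked for on [D] only, because the norm invariance behind it is available
    for permutation matrices. *)
Lemma argmin_argmax (R : realType) (T : Type) (D : set T) (f g : T -> R) :
  (forall x y, D x -> D y -> (f x <= f y) = (g y <= g x)) ->
  argmin D f = argmax D g.
Proof.
move=> fg; apply/seteqP; split=> x [Dx xopt]; split=> // y Dy.
  by rewrite -fg // xopt.
by rewrite fg // xopt.
Qed.

Theorem theorem4p1 (R : realType) (L : nat) (d : 'I_L.+1 -> nat)
    (theta_a theta_b : mlp R d)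
    (ra rb : 'I_L -> nat)
    (ua : forall k : 'I_L, 'I_(ra k) -> 'cV[R]_(d (lout k)))
    (sa : forall k : 'I_L, 'I_(ra k) -> R)
    (va : forall k : 'I_L, 'I_(ra k) -> 'cV[R]_(d (lin k)))
    (ub : forall k : 'I_L, 'I_(rb k) -> 'cV[R]_(d (lout k)))
    (sb : forall k : 'I_L, 'I_(rb k) -> R)
    (vb : forall k : 'I_L, 'I_(rb k) -> 'cV[R]_(d (lin k)))
    (svd_a : forall k : 'I_L, is_svd (theta_a k) (ua k) (sa k) (va k))
    (svd_b : forall k : 'I_L, is_svd (theta_b k) (ub k) (sb k) (vb k)) :
  argmin (perm_tuples R d) (fun P => sqdist theta_a (permute P theta_b))
  = argmax (perm_tuples R d) (fun P =>
      \sum_(k < L) \sum_(i < ra k) \sum_(j < rb k)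
        sa k i * sb k j
        * dot (ua k i) (P (lout k) *m ub k j)
        * dot (va k i) (P (lin k) *m vb k j)).
Proof.
set g := (X in _ = argmax _ X).
have sqdistE P : perm_tuples R d P -> sqdist theta_a (permute P theta_b)
    = \sum_(k < L) (frobenius (theta_a k) ^+ 2 + frobenius (theta_b k) ^+ 2)
      - 2 * g P.
  case=> permP _ _; rewrite /g mulr_sumr -sumrB; apply: eq_bigr => k _.
  (* Unfolding [permute] exposes the product [P *m A *m Q^T], so the norm of the permuted layer
     becomes that of [theta_b k]. *)
  rewrite frobenius_sqrB frobenius_sqr_orthogonal;
    try exact: perm_mx_orthogonal.
  congr (_ - 2 * _).
  case: (svd_a k) (svd_b k) => _ _ _ _ Wa [_ _ _ _ Wb].
  by rewrite /permute {1}Wa Wb mxtrace_sum_rank1.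
apply: argmin_argmax => P P' DP DP'.
(* The common constant cancels, the minus sign reverses the order, and the positive factor 2 drops
   out. *)
by rewrite !sqdistE // lerD2l lerN2 ler_pM2l.
Qed.
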